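(* Let $(C,\Omega)$ be a pure finite chain complex of order $d\geq1$ over a principal ring $R$, and let $\Omega_d$ be a basis of $C_d$ with $k_d\geq1$ elements. Let there be $n<k_d$ precritical elements $g_1,\ldots,g_n$ in $\Omega_d$. Let $\Omega_d$ be ordered in such a way that the noncritical elements come first: $$\Omega_d=\{e_1,\ldots,e_m,g_1,\ldots,g_n\},\qquad m+n=k_d.$$ Then $H_d(C)\cong R^n$.
   Context: A principal ring $R$ is an integral domain (commutative with $1$) all of whose ideals are principal. A chain complex $(C,\Omega)$ over $R$ consists of free $R$-modules $C_\nu$ ($\nu\geq 0$), each with a fixed finite (possibly empty) basis $\Omega_\nu=\{e^\nu_1,\ldots,e^\nu_{k_\nu}\}$, and $R$-linear maps $\partial_\nu\colon C_\nu\to C_{\nu-1}$ ($\nu\geq1$), $\partial_0\colon C_0\to 0$, with $\partial_\nu\circ\partial_{\nu+1}=0$; $\Omega=\bigcup_\nu\Omega_\nu$. The basis is fixed except for permutations of its elements. The complex is finite of order $d$ if $C_\nu=0$ for $\nu>d$ and $C_d\neq0$. $H_\nu(C)=\ker\partial_\nu/\operatorname{im}\partial_{\nu+1}$. For $x=\sum_i a_ie^\nu_i\in C_\nu$, $\operatorname{supp}(x)=\{e^\nu_i\mid a_i\neq0\}$ and $\operatorname{bd}(x)=\operatorname{supp}(\partial_\nu x)$. A finite complex of order $d$ is pure if every $e\in\Omega_\nu$, $0\leq\nu\leq d-1$, lies in $\operatorname{bd}(f)$ for some $f\in\Omega_{\nu+1}$. Let $\Gamma$ be the set of maximal basis elements,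 i.e. of those $e\in\Omega$ with $e\notin\operatorname{bd}(f)$ for all $f\in\Omega$ (in a pure complex of order $d$, $\Gamma=\Omega_d$). Let each $\Omega_\nu$ have an ordering in which the elements of $\Omega_\nu\setminus\Gamma$ come first. A basis element $e^\nu_j\in\Omega_\nu\cap\Gamma$ with $j\geq2$ is called: critical if there exist $a_i\in R$, $1\leq i\leq j-1$, so that $\partial_\nu(e^\nu_j)=\sum_{i=1}^{j-1}a_i\partial_\nu(e^\nu_i)$; precritical if there exist $a_i\in R$, $1\leq i\leq j$, $a_j\neq0$, so that $a_j\partial_\nu(e^\nu_j)=\sum_{i=1}^{j-1}a_i\partial_\nu(e^\nu_i)$; noncritical if it is neither critical nor precritical. (The definition is made only for $j\geq2$; a critical element is always precritical.)
   Formalization: The first basis element of the ordering, for which the text defines no class, is counted as precritical if its boundary is 0 and as noncritical otherwise; without this the claim fails, e.g. for C_0=R, C_1=R^2, ∂e_1=0, ∂e_2=1. *)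

(* Defs.v *)
From HB Require Import structures.
From mathcomp Require Import all_boot all_order all_algebra.
From mathcomp Require Import perm boolp.

Set Implicit Arguments.
Unset Strict Implicit.
Unset Printing Implicit Defensive.

Import GRing.Theory.
Local Open Scope ring_scope.

Definition is_ideal (R : idomainType) (I : R -> Prop) : Prop :=
  [/\ I 0, forall x y, I x -> I y -> I (x + y) & forall a x, I x -> I (a * x)].

Definition principal_ring (R : idomainType) : Prop :=
  forall I : R -> Prop, is_ideal I ->
    exists g : R, forall x, I x <-> exists a, x = a * g.

(* The library quotients a Z-module by a subgroup ([Quotient.quot]); over a
   submodule the quotient inherits the scalar action. *)
Section LmodQuotient.
Variables (R : nzRingType) (V : lmodType R) (W : submodClosed V).

Definition submod_zmod : zmodClosed V :=
  HB.pack (GRing.SubmodClosed.sort W)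
    (GRing.isZmodClosed.Build V (GRing.SubmodClosed.sort W)
       (GRing.submod_closedB (GRing.submodClosedP W))).

Definition lmod_quot : Type := Quotient.quot submod_zmod.

HB.instance Definition _ := GRing.Zmodule.on lmod_quot.

Definition lmod_proj (x : V) : lmod_quot := (\pi_(Quotient.quot submod_zmod) x)%qT.

Definition lmod_quot_scale (a : R) (u : lmod_quot) : lmod_quot :=
  lmod_proj (a *: repr (u : Quotient.quot submod_zmod)).

Lemma lmod_proj_eq x y : lmod_proj x = lmod_proj y <-> x - y \in W.
Proof.
have -> : (x - y \in W) = (lmod_proj x == lmod_proj y).
  exact: (Quotient.idealrBE submod_zmod).
by split=> /eqP.
Qed.

Lemma lmod_projK (u : lmod_quot) : lmod_proj (repr (u : Quotient.quot submod_zmod)) = u.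
Proof. exact: reprK. Qed.

Lemma lmod_projD x y : lmod_proj (x + y) = lmod_proj x + lmod_proj y.
Proof. exact: (raddfD (\pi_(Quotient.quot submod_zmod))%qT). Qed.

Lemma lmod_projZ a x : lmod_proj (a *: x) = lmod_quot_scale a (lmod_proj x).
Proof.
apply/lmod_proj_eq; rewrite -scalerBr rpredZ //.
by apply/lmod_proj_eq; rewrite lmod_projK.
Qed.

Lemma lmod_quot_scaleA a b u :
  lmod_quot_scale a (lmod_quot_scale b u) = lmod_quot_scale (a * b) u.
Proof. by rewrite -(lmod_projK u) -!lmod_projZ scalerA. Qed.

Lemma lmod_quot_scale1 : left_id 1 lmod_quot_scale.
Proof. by move=> u; rewrite -(lmod_projK u) -!lmod_projZ scale1r. Qed.

Lemma lmod_quot_scaleDr : right_distributive lmod_quot_scale +%R.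
Proof.
move=> a u v; rewrite -(lmod_projK u) -(lmod_projK v).
by rewrite -lmod_projD -!lmod_projZ scalerDr lmod_projD.
Qed.

Lemma lmod_quot_scaleDl u : {morph lmod_quot_scale^~ u : a b / a + b}.
Proof.
move=> a b; rewrite -(lmod_projK u).
by rewrite -!lmod_projZ scalerDl lmod_projD.
Qed.

HB.instance Definition _ := GRing.Zmodule_isLmodule.Build R lmod_quot
  lmod_quot_scaleA lmod_quot_scale1 lmod_quot_scaleDr lmod_quot_scaleDl.

End LmodQuotient.

Definition is_basis (R : nzRingType) (V : lmodType R) (k : nat)
    (e : 'I_k -> V) : Prop :=
  forall x : V, exists! a : {ffun 'I_k -> R}, x = \sum_i a i *: e i.

(* [chain_bd C nu] is the differential in degree nu.+1; the one in degree 0 is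
   added by [bdry] below.  The basis element of C_nu of index i is
   [chain_basis C nu i], and basis elements are referred to by their index. *)
Record chain_complex (R : idomainType) := ChainComplex {
  chain_mod :> nat -> lmodType R;
  chain_rank : nat -> nat;
  chain_basis : forall nu, 'I_(chain_rank nu) -> chain_mod nu;
  chain_basisP : forall nu, is_basis (@chain_basis nu);
  chain_bd : forall nu, {linear chain_mod nu.+1 -> chain_mod nu};
  chain_bdK : forall nu (x : chain_mod nu.+2),
    chain_bd nu (chain_bd nu.+1 x) = 0 }.

Arguments chain_rank {R} c nu.
Arguments chain_basis {R} c nu i.
Arguments chain_bd {R} c nu.

Section ChainComplex.
Variables (R : idomainType) (C : chain_complex R).

Local Notation k := (chain_rank C).

(* The target of the differential: C_(nu-1), and the zero module if nu = 0. *)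
Definition bdry_target (nu : nat) : lmodType R :=
  if nu is nu'.+1 then C nu' else 'rV[R]_0.

Definition bdry (nu : nat) : {linear C nu -> bdry_target nu} :=
  match nu return {linear C nu -> bdry_target nu} with
  | 0 => \0
  | nu'.+1 => chain_bd C nu'
  end.

Lemma coord_exists nu (x : C nu) :
  exists a : {ffun 'I_(k nu) -> R}, x == \sum_i a i *: chain_basis C nu i.
Proof. by have [a [/eqP Ha _]] := chain_basisP x; exists a. Qed.

Definition coord nu (x : C nu) : {ffun 'I_(k nu) -> R} :=
  xchoose (coord_exists x).

Definition supp nu (x : C nu) : {set 'I_(k nu)} := [set i | coord x i != 0].

Definition bd nu (f : 'I_(k nu.+1)) : {set 'I_(k nu)} :=
  supp (chain_bd C nu (chain_basis C nu.+1 f)).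

Definition finite_of_order (d : nat) : Prop :=
  (forall nu, (d < nu)%N -> forall x : C nu, x = 0)
  /\ exists x : C d, x != 0.

Definition pure (d : nat) : Prop :=
  forall nu, (nu < d)%N -> forall e : 'I_(k nu),
    exists f : 'I_(k nu.+1), e \in bd f.

Definition cycles nu : {pred C nu} := fun x => bdry nu x == 0.

Lemma cycles_submod nu : submod_closed (@cycles nu).
Proof.
split=> [|a x y]; rewrite /cycles !unfold_in ?linear0 //.
by move=> /eqP x0 /eqP y0; rewrite linearP x0 y0 scaler0 addr0.
Qed.

HB.instance Definition _ nu :=
  GRing.isSubmodClosed.Build R (C nu) (@cycles nu) (cycles_submod nu).

Record chain_cycle nu := ChainCycle { cycle_val :> C nu; _ : cycle_val \in @cycles nu }.

HB.instance Definition _ nu := [isSub for @cycle_val nu].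
HB.instance Definition _ nu := [Choice of chain_cycle nu by <:].
HB.instance Definition _ nu := [SubChoice_isSubLmodule of chain_cycle nu by <:].

Definition boundaries nu : {pred chain_cycle nu} :=
  fun z => `[< exists y : C nu.+1, cycle_val z = chain_bd C nu y >].

Lemma boundaries_submod nu : submod_closed (@boundaries nu).
Proof.
split=> [|a u v]; rewrite /boundaries !unfold_in.
  by apply/asboolP; exists 0; rewrite linear0.
move=> /asboolP [x ux] /asboolP [y vy]; apply/asboolP.
by exists (a *: x + y); rewrite linearP -ux -vy.
Qed.

HB.instance Definition _ nu :=
  GRing.isSubmodClosed.Build R (chain_cycle nu) (@boundaries nu)
    (boundaries_submod nu).

Definition homology (nu : nat) : lmodType R := lmod_quot (@boundaries nu).

(* Since bd f is contained in Omega_nu for f in Omega_(nu+1), only those f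
   matter for the maximality of an element of Omega_nu. *)
Definition maximal nu (e : 'I_(k nu)) : Prop :=
  forall f : 'I_(k nu.+1), e \notin bd f.

(* A family of permutations [o] orders every Omega_nu: [o nu i] is the
   (0-based) position of the basis element of index i. *)
Definition admissible_order (o : forall nu, 'S_(k nu)) : Prop :=
  forall nu (i j : 'I_(k nu)), ~ maximal i -> maximal j -> (o nu i < o nu j)%N.

Section Critical.
Variables (o : forall nu, 'S_(k nu)) (nu : nat).
Implicit Type j : 'I_(k nu).

Local Notation e := (chain_basis C nu).

(* The notions are usually introduced from the second element on.  Here the
   first element is included, with empty sums: it is (pre)critical if its
   boundary is 0 and noncritical otherwise.  Leaving it unclassified would make
   the count of precritical elements wrong when its boundary vanishes: in
   0 -> R --0--> 0 -> 0 the top homology is R, which that element generates. *)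

Definition critical j : Prop :=
  maximal j /\ exists a : 'I_(k nu) -> R,
    bdry nu (e j) = \sum_(i | (o nu i < o nu j)%N) a i *: bdry nu (e i).

Definition precritical j : Prop :=
  maximal j /\ exists (b : R) (a : 'I_(k nu) -> R), b != 0 /\
    b *: bdry nu (e j) = \sum_(i | (o nu i < o nu j)%N) a i *: bdry nu (e i).

Definition noncritical j : Prop :=
  [/\ maximal j, ~ critical j & ~ precritical j].

End Critical.

End ChainComplex.

(* Main.v *)
Require Import Defs.
From HB Require Import structures.
From mathcomp Require Import all_boot all_order all_algebra perm.
From mathcomp Require Import boolp.
(* [coord] is to mean coordinates in a chain complex, not in a vector space. *)
Import Defs.

(** In degree [d] there are no boundaries, so [H_d(C)] is the module of cycles,
    a submodule of the free module [C_d]; over a principal ring it is free, and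
    only its rank has to be found.  Order the basis of [C_d] by [o] and call the
    last basis element with a nonzero coefficient in a cycle its leading
    element.  A relation [b *: bdry e_j = \sum_(i < j) a_i *: bdry e_i] with
    [b != 0] is the same thing as a cycle [b *: e_j - \sum_(i < j) a_i *: e_i]
    led by [e_j], so the precritical elements are exactly the leading elements
    of cycles ([precritical_leading]).

    For fixed [j], the coefficients at [e_j] of the cycles supported in
    positions up to [j] form an ideal; let the cycle [z_j] realise a generator
    of it.  The [z_j] with [j] precritical form a basis of the cycles
    ([leading_basis]): they are independent because their leading elements are
    distinct, and they generate because a multiple of [z_j] cancels the
    coefficient at [e_j] of any cycle supported up to [j], leaving a cycle
    supported strictly below.  There are [n] of them. *)

Set Implicit Arguments.
Unset Strict Implicit.
Unset Printing Implicit Defensive.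

Import GRing.Theory.
Local Open Scope ring_scope.

(** * Bases and coordinates *)

Lemma is_basis_iso (R : nzRingType) (V : lmodType R) (k : nat)
    (e : 'I_k -> V) :
  is_basis e -> exists f : {linear V -> 'rV[R]_k}, bijective f.
Proof.
move=> be; pose g (v : 'rV[R]_k) := \sum_i v 0 i *: e i.
have g_lin : linear g.
  move=> a u v; rewrite /g scaler_sumr -big_split; apply: eq_bigr => i _.
  by rewrite !mxE scalerDl scalerA.
pose gL : {linear 'rV[R]_k -> V} :=
  HB.pack g (GRing.isLinear.Build R 'rV[R]_k V *:%R g g_lin).
have [f fK] : {f : V -> 'rV[R]_k & forall x, g (f x) = x}.
  apply: (choice (P := fun x v => g v = x)) => x; have [a [-> _]] := be x.
  by exists (\row_i a i); apply: eq_bigr => i _; rewrite mxE.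
have gK : cancel g f.
  move=> v; have [a [_ a_uniq]] := be (g v).
  have av : a = [ffun i => v 0 i].
    by apply: a_uniq; apply: eq_bigr => i _; rewrite ffunE.
  have af : a = [ffun i => f (g v) 0 i].
    by apply: a_uniq; rewrite -{1}[g v]fK; apply: eq_bigr => i _; rewrite ffunE.
  apply/rowP => i; have /ffunP/(_ i) : [ffun i => f (g v) 0 i] = [ffun i => v 0 i].
    by rewrite -af av.
  by rewrite !ffunE.
have f_lin : linear f := can2_linear (f := gL) gK fK.
pose fL : {linear V -> 'rV[R]_k} :=
  HB.pack f (GRing.isLinear.Build R V 'rV[R]_k *:%R f f_lin).
by exists fL, g.
Qed.

Section Coord.
Variables (R : idomainType) (C : chain_complex R) (nu : nat).
Local Notation e := (chain_basis C nu).

Lemma coord_sum (x : C nu) : x = \sum_i coord x i *: e i.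
Proof. exact/eqP/(xchooseP (coord_exists x)). Qed.

Lemma coord_uniq (x : C nu) (a : 'I_(chain_rank C nu) -> R) :
  x = \sum_i a i *: e i -> coord x =1 a.
Proof.
move=> xa; have [c [_ c_uniq]] := chain_basisP x.
have ca : c = finfun a.
  by apply: c_uniq; rewrite {1}xa; apply: eq_bigr => i _; rewrite ffunE.
by move=> i; rewrite -(c_uniq _ (coord_sum x)) ca ffunE.
Qed.

Lemma coordP (a : R) (x y : C nu) i :
  coord (a *: x + y) i = a * coord x i + coord y i.
Proof.
rewrite (@coord_uniq _ (fun j => a * coord x j + coord y j)) //.
rewrite {1}(coord_sum x) {1}(coord_sum y) scaler_sumr -big_split.
by apply: eq_bigr => j _; rewrite scalerDl scalerA.
Qed.

End Coord.

(** * Leading coefficients over a principal ring *)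

Section Leading.
Variables (R : idomainType) (V : lmodType R) (I : finType) (pos : I -> nat).
Hypothesis pos_inj : injective pos.
Variable c : V -> I -> R.
Hypothesis c_lin : forall a x y i, c (a *: x + y) i = a * c x i + c y i.
Hypothesis c_inj : forall x, (forall i, c x i = 0) -> x = 0.

Definition supported_upto (j : I) (x : V) : Prop :=
  forall l, (pos j < pos l)%N -> c x l = 0.

Lemma functional0 i : c 0 i = 0.
Proof.
have := c_lin (-1) 0 0 i.
by rewrite scaler0 addr0 mulN1r addNr.
Qed.

Lemma functional_sum (J : finType) (P : pred J) (a : J -> R) (z : J -> V) i :
  c (\sum_(j | P j) a j *: z j) i = \sum_(j | P j) a j * c (z j) i.
Proof.
elim/big_rec2: _ => [|j r x _ <-]; first exact: functional0.
by rewrite c_lin.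
Qed.

Lemma leading_ideal j :
  is_ideal (fun r => exists x, supported_upto j x /\ c x j = r).
Proof.
split.
- by exists 0; split=> [l _|]; rewrite functional0.
- move=> _ _ [x [ux <-]] [y [uy <-]]; exists (1 *: x + y).
  by split=> [l jl|]; rewrite c_lin mul1r // ux // uy // addr0.
move=> a _ [x [ux <-]]; exists (a *: x + 0).
split=> [l jl|]; rewrite c_lin functional0 addr0 //.
by rewrite ux // mulr0.
Qed.

(** The Gaussian elimination behind the freeness of submodules of a free module
    of finite rank, keeping track of which coordinates are pivots. *)
Lemma leading_basis (S : {set I}) :
    principal_ring R ->
    (forall j, j \in S <-> exists x, supported_upto j x /\ c x j != 0) ->
  exists z : 'I_#|S| -> V, is_basis z.
Proof.
move=> hR SP.
pose generates j y := supported_upto j y /\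
  forall x, supported_upto j x -> exists a, c x j = a * c y j.
have [z zP] : exists z : I -> V, forall j, generates j (z j).
  apply: fin_all_exists => j; have [g gP] := hR _ (leading_ideal j).
  have [|x [ux xg]] := (gP g).2; first by exists 1; rewrite mul1r.
  exists x; split=> // y uy; rewrite xg; apply/(gP (c y j)).1.
  by exists y.
have z_neq0 j : j \in S -> c (z j) j != 0.
  move=> /SP[x [ux xj]]; have [a xa] := (zP j).2 x ux.
  by apply: contraNneq xj => zj; rewrite xa zj mulr0.
(* Induction on a strict bound [p] of the positions in the support. *)
have gen p x : (forall l, (p <= pos l)%N -> c x l = 0) ->
    exists a : I -> R, x = \sum_(j in S) a j *: z j.
  elim: p x => [|p IHp] x ux.
    exists (fun=> 0); rewrite big1 => [|j _]; last by rewrite scale0r.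
    by apply: c_inj => l; apply: ux.
  case: (pickP (fun j => pos j == p)) => [j /eqP jp | no_p]; last first.
    apply: IHp => l; rewrite leq_eqVlt eq_sym no_p; exact: ux.
  have uxj : supported_upto j x by move=> l; rewrite jp; apply: ux.
  case: (boolP (j \in S)) => [jS | jNS]; last first.
    apply: IHp => l; rewrite leq_eqVlt -jp => /orP[/eqP/pos_inj <-|/uxj //].
    apply/eqP; apply: contraNT jNS => xj.
    by apply/SP; exists x.
  have [b xb] := (zP j).2 x uxj.
  have [|a ya] := IHp ((- b) *: z j + x).
    move=> l; rewrite c_lin leq_eqVlt -jp => /orP[/eqP/pos_inj <-|jl].
      by rewrite xb mulNr addNr.
    by rewrite (zP j).1 // mulr0 add0r uxj.
  exists (fun i => a i + (i == j)%:R * b).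
  under eq_bigr do rewrite scalerDl.
  rewrite big_split -ya /= (bigD1 j) //= eqxx mul1r big1 => [|i /andP[_ /negPf ij]].
    by rewrite addr0 scaleNr addrC addrA subrr add0r.
  by rewrite ij mul0r scale0r.
have indep (a : I -> R) : \sum_(j in S) a j *: z j = 0 ->
    forall j, j \in S -> a j = 0.
  move=> a0 j jS; apply/eqP/negPn/negP => aj.
  have Pj : (j \in S) && (a j != 0) by rewrite jS.
  have [l /andP[lS al] l_max] :=
    @arg_maxnP _ j (fun i => (i \in S) && (a i != 0)) pos Pj.
  (* Only the term of index [l] contributes to the coordinate at [l]. *)
  have : c (\sum_(i in S) a i *: z i) l = 0 by rewrite a0 functional0.
  rewrite functional_sum (bigD1 l) //= big1 ?addr0.
    by apply/eqP; rewrite mulf_neq0 // z_neq0.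
  move=> i /andP[iS il]; have [->|ai] := eqVneq (a i) 0; first by rewrite mul0r.
  rewrite (zP i).1 ?mulr0 // ltn_neqAle (inj_eq pos_inj) il /=.
  by apply: l_max; rewrite iS.
exists (fun i => z (enum_val i)) => x.
have [|a xa] := gen (\max_i pos i).+1 x.
  by move=> l; rewrite ltnNge leq_bigmax.
have xa' : x = \sum_(i < #|S|) a (enum_val i) *: z (enum_val i).
  by rewrite [LHS]xa big_enum_val.
exists [ffun i : 'I_#|S| => a (enum_val i)]; split.
  by rewrite [LHS]xa'; apply: eq_bigr => i _; rewrite ffunE.
move=> b xb; apply/ffunP => i0; rewrite ffunE.
have S_i0 := enum_valP i0.
pose b' j := b (enum_rank_in S_i0 j).
have /(_ _ S_i0)/subr0_eq : forall j, j \in S -> a j - b' j = 0.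
  have xb' : x = \sum_(j in S) b' j *: z j.
    rewrite [RHS]big_enum_val [LHS]xb.
    by apply: eq_bigr => i _; rewrite /b' enum_valK_in.
  apply: indep; under eq_bigr do rewrite scalerBl.
  by rewrite sumrB -xa -xb' subrr.
by rewrite /b' enum_valK_in.
Qed.

End Leading.

(** * Precritical elements and top-dimensional homology *)

Lemma precritical_leading (R : idomainType) (C : chain_complex R) (nu : nat)
    (o : forall nu, 'S_(chain_rank C nu)) (j : 'I_(chain_rank C nu)) :
  maximal j ->
  precritical o j <->
  exists x : C nu, [/\ bdry C nu x = 0,
    forall l, (o nu j < o nu l)%N -> coord x l = 0 & coord x j != 0].
Proof.
move=> jmax; pose e := chain_basis C nu; split.
  case=> _ [b [a [b0 ba]]].
  pose w i := if i == j then b else if (o nu i < o nu j)%N then - a i else 0.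
  have cx : coord (\sum_i w i *: e i) =1 w by exact: coord_uniq.
  exists (\sum_i w i *: e i); split.
  - rewrite linear_sum (bigD1 j) //= linearZ /= {1}/w eqxx ba.
    rewrite [X in _ + X](bigID (fun i => (o nu i < o nu j)%N)) /=.
    rewrite [X in _ + (_ + X)]big1 ?addr0; last first.
      move=> i /andP[/negPf ij /negPf ilj].
      by rewrite /w ij ilj scale0r linear0.
    apply/eqP; rewrite addr_eq0 -sumrN; apply/eqP.
    apply: eq_big => [i|i ilj].
      by case: (eqVneq i j) => [->|]; rewrite ?ltnn.
    have /negPf ij : i != j by apply: contraTneq ilj => ->; rewrite ltnn.
    by rewrite /w ij ilj linearZ /= scaleNr opprK.
  - move=> l jl; rewrite cx /w ltnNge (ltnW jl) /=.
    by case: eqP jl => // ->; rewrite ltnn.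
  by rewrite cx /w eqxx.
case=> x [x0 ux xj]; split=> //; exists (coord x j), (fun i => - coord x i).
split=> //; move: x0; rewrite {1}[x]coord_sum linear_sum (bigD1 j) //= linearZ /=.
move=> /eqP; rewrite addr_eq0 => /eqP ->.
rewrite (bigID (fun i => (o nu i < o nu j)%N)) /= [X in _ + X]big1 ?addr0.
  rewrite -sumrN; apply: eq_big => [i|i _].
    by case: (eqVneq i j) => [->|]; rewrite ?ltnn.
  by rewrite linearZ /= scaleNr.
move=> i /andP[ij]; rewrite -leqNgt leq_eqVlt => /orP[|ji].
  by move=> /eqP/val_inj/perm_inj ji; rewrite ji eqxx in ij.
by rewrite ux // scale0r linear0.
Qed.

(** A section of the projection of a cycle onto its class.  It is linear, and
    an isomorphism onto the cycles, once all boundaries vanish. *)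
Definition homology_lift (R : idomainType) (C : chain_complex R) (nu : nat)
    (u : homology C nu) : C nu :=
  cycle_val (repr (u : Quotient.quot (submod_zmod (@boundaries R C nu)))).

Section TopHomology.
Variables (R : idomainType) (C : chain_complex R) (d : nat).
Hypothesis top : forall x : C d.+1, x = 0.

Lemma top_lmod_proj_inj :
  injective (lmod_proj (@boundaries R C d)).
Proof.
move=> u v /lmod_proj_eq; rewrite unfold_in => /asboolP[y].
rewrite (top y) linear0 => uv0; apply/subr0_eq.
exact: val_inj.
Qed.

Lemma homology_liftP a (u v : homology C d) :
  homology_lift (a *: u + v) = a *: homology_lift u + homology_lift v.
Proof.
rewrite /homology_lift -[RHS]/(cycle_val (a *: repr _ + repr _)).
congr cycle_val; apply: top_lmod_proj_inj.
by rewrite lmod_projD lmod_projZ !lmod_projK.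
Qed.

Lemma homology_lift_inj0 (u : homology C d) : homology_lift u = 0 -> u = 0.
Proof.
move=> u0; rewrite -(lmod_projK u) (_ : repr _ = 0); first exact: raddf0.
exact: val_inj.
Qed.

Lemma homology_lift_bdry (u : homology C d) : bdry C d (homology_lift u) = 0.
Proof.
rewrite /homology_lift; case: (repr _) => x x_cyc; exact/eqP.
Qed.

Lemma homology_lift_surj (x : C d) :
  bdry C d x = 0 -> exists u, homology_lift u = x.
Proof.
move=> /eqP x_cyc; pose z := @ChainCycle R C d x x_cyc.
exists (lmod_proj (@boundaries R C d) z); rewrite /homology_lift.
by rewrite (_ : repr _ = z) //; apply: top_lmod_proj_inj; rewrite lmod_projK.
Qed.

End TopHomology.

Lemma card_ord_geq (m n k : nat) :
  (m + n)%N = k -> #|[set i : 'I_k | (m <= i)%N]| = n.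
Proof.
move=> <-; rewrite -[RHS](card_ord n) -(card_imset _ (@rshift_inj m n)).
apply: eq_card => i; rewrite inE; apply/idP/imsetP => [mi|[j _ ->]].
  case: (splitP i) mi => [j -> | j ij _]; first by rewrite leqNgt ltn_ord.
  by exists j => //; apply: val_inj.
exact: leq_addr.
Qed.

Theorem theorem3p14 (R : idomainType) (hR : principal_ring R)
    (C : chain_complex R) (d : nat) (hd : (1 <= d)%N)
    (hfin : finite_of_order C d) (hpure : pure C d)
    (hk : (1 <= chain_rank C d)%N)
    (o : forall nu, 'S_(chain_rank C nu)) (ho : admissible_order o)
    (m n : nat) (hn : (n < chain_rank C d)%N) (hmn : (m + n)%N = chain_rank C d)
    (t : 'S_(chain_rank C d))
    (hnon : forall i : 'I_(chain_rank C d), noncritical o i <-> (t i < m)%N)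
    (hpre : forall i : 'I_(chain_rank C d), precritical o i <-> (m <= t i)%N) :
  exists f : {linear homology C d -> 'rV[R]_n}, bijective f.
Proof.
have top : forall x : C d.+1, x = 0 by move=> x; apply: hfin.1.
have all_max i : maximal (C := C) (nu := d) i.
  by case: (ltnP (t i) m) => [/hnon[]|/hpre[]].
pose S := [set i | (m <= t i)%N].
have -> : n = #|S|.
  have -> : S = t @^-1: [set i : 'I_(chain_rank C d) | (m <= i)%N].
    by apply/setP => i; rewrite !inE.
  by rewrite (card_preimset _ perm_inj) (card_ord_geq hmn).
pose c (u : homology C d) i := coord (homology_lift u) i.
have pos_inj : injective (fun i => o d i : nat).
  by move=> i j /val_inj/perm_inj.
have [||j|z /is_basis_iso //] := @leading_basis R _ _ _ pos_inj c _ _ S hR.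
- by move=> a u v i; rewrite /c homology_liftP // coordP.
- move=> u u0; apply: homology_lift_inj0; rewrite [LHS]coord_sum.
  by rewrite big1 // => i _; rewrite -/(c u i) u0 scale0r.
rewrite inE; split.
  move=> /hpre/(precritical_leading _ (all_max j))[x [/(homology_lift_surj top)]].
  by case=> u <- ux xj; exists u.
case=> u [uu uj]; apply/hpre/(precritical_leading _ (all_max j)).
by exists (homology_lift u); split=> //; exact: homology_lift_bdry.
Qed.
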